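(* Let $n\in\mathbb{N}\setminus\{1,2\}$, let $\Lambda_n(t,W)\in\mathcal{M}(\mathcal{O}_n)$ be a cyclotomic model set, and let $R>0$. Then: (a) The set $\mathcal{D}_{<R}(\Lambda_n(t,W))$ is determined by two $X$-rays in $\mathcal{O}_n$-directions. (b) The set $\mathcal{D}_{<R}(\Lambda_n(t,W))$ is determined by two projections on orthogonal complements of $1$-dimensional $\mathcal{O}_n$-subspaces.
   Context: Identify $\mathbb{C}$ with $\mathbb{R}^2$. Let $\zeta_n=e^{2\pi i/n}$, $\mathbb{K}_n=\mathbb{Q}(\zeta_n)$, $\mathcal{O}_n=\mathbb{Z}[\zeta_n]$, and let $\phi$ be Euler's totient function. Cyclotomic model sets. For $n\in\mathbb{N}\setminus\{1,2\}$, choose exactly one automorphism from each pair of complex conjugate automorphisms in $\mathrm{Gal}(\mathbb{K}_n/\mathbb{Q})$, obtaining $\sigma_1=\mathrm{id},\sigma_2,\dots,\sigma_{\phi(n)/2}$. The associated star map $\star:\mathcal{O}_n\to(\mathbb{R}^2)^{\phi(n)/2-1}$ is $z\mapsto(\sigma_2(z),\dots,\sigma_{\phi(n)/2}(z))$; if $n\in\{3,4,6\}$, $(\mathbb{R}^2)^{0}$ is the trivial group $\{0\}$ and the star map is $0$. A window is a set $W\subset(\mathbb{R}^2)^{\phi(n)/2-1}$ with $\varnothing\neq W^\circ\subset W\subset\overline{W^\circ}$ and $\overline{W^\circ}$ compact. For a window $W$ and $t\in\mathbb{R}^2$ set $\Lambda_n(t,W)=t+\{z\in\mathcal{O}_n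 : z^\star\in W\}$. $\mathcal{M}(\mathcal{O}_n)$ is the collection of all sets $\Lambda_n(t,W)$ (all $t$, all windows $W$, all choices of star map); its elements are called cyclotomic model sets. For $S\subset\mathbb{R}^2$, $\mathcal{D}_{<R}(S)$ is the set of all subsets of $S$ of diameter less than $R$ (finite sets when $S$ is a cyclotomic model set). A direction is an element of $\mathbb{S}^1$; an $\mathcal{O}_n$-direction is a direction parallel to a non-zero element of $\mathcal{O}_n$; a $1$-dimensional $\mathcal{O}_n$-subspace is a line $\mathbb{R}o$ with $o\in\mathcal{O}_n\setminus\{0\}$. For a finite $F\subset\mathbb{R}^2$ and a direction $u$, the $X$-ray $X_uF$ is the function assigning to each line $\ell$ parallel to $u$ the number $\operatorname{card}(F\cap\ell)$. $F|T^\perp$ denotes the orthogonal projection (canonical inner product) of $F$ on $T^\perp$. A collection $\mathcal{E}$ of finite subsets of $\mathbb{R}^2$ is determined by $m$ $X$-rays in $\mathcal{O}_n$-directions if there is a set $U$ of $m$ pairwise non-parallel $\mathcal{O}_n$-directions such that for all $F,F'\in\mathcal{E}$: $(X_uF=X_uF'\ \forall u\in U)\Rightarrow F=F'$. It is determined by $m$ projections on orthogonal complements of $1$-dimensional $\mathcal{O}_n$-subspaces if there is a set $\mathcal{T}$ of $m$ pairwise non-parallel $1$-dimensional $\mathcal{O}_n$-subspaces such that for all $F,F'\in\mathcal{E}$: $(F|T^\perp=F'|T^\perp\ \forall T\in\mathcal{T})\Rightarrow F=F'$. *)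

(* Defs.v *)
From HB Require Import structures.
From mathcomp Require Import all_boot all_order all_algebra.
From mathcomp Require Import all_classical all_reals all_analysis.
From mathcomp Require Import finmap complex.

Set Implicit Arguments.
Unset Strict Implicit.
Unset Printing Implicit Defensive.

Import Order.TTheory GRing.Theory Num.Theory.
Import numFieldNormedType.Exports.

Local Open Scope classical_set_scope.
Local Open Scope complex_scope.
Local Open Scope ring_scope.

(* The plane R^2, identified with C, is R[i]. *)

Definition zeta (R : realType) (n : nat) : R[i] :=
  cos (2 * pi / n%:R) +i* sin (2 * pi / n%:R).

(* Q(zeta_n), as the smallest subfield of C containing zeta_n. *)
Definition cyclotomic_pred (R : realType) (n : nat) : {pred R[i]} :=
  fun x => `[< forall S : {pred R[i]},
    GRing.divring_closed S -> zeta R n \in S -> x \in S >].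
Arguments cyclotomic_pred : clear implicits.

Lemma cyclotomic_pred_divring_closed (R : realType) (n : nat) :
  GRing.divring_closed (cyclotomic_pred R n).
Proof.
split=> [|x y /asboolP hx /asboolP hy|x y /asboolP hx /asboolP hy];
  apply/asboolP => S hS hz; have [S1 SB SD] := hS.
- exact: S1.
- by apply: SB; [exact: hx | exact: hy].
- by apply: SD; [exact: hx | exact: hy].
Qed.

Section CyclotomicField.
Variables (R : realType) (n : nat).

HB.instance Definition _ :=
  GRing.isDivringClosed.Build R[i] (cyclotomic_pred R n)
    (cyclotomic_pred_divring_closed R n).

Record cyclotomic_field : Type := CyclotomicField {
  cyclotomic_val :> R[i];
  _ : cyclotomic_val \in cyclotomic_pred R n
}.

HB.instance Definition _ := [isSub for cyclotomic_val].
HB.instance Definition _ := [Choice of cyclotomic_field by <:].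
HB.instance Definition _ :=
  [SubChoice_isSubIntegralDomain of cyclotomic_field by <:].
HB.instance Definition _ :=
  [SubIntegralDomain_isSubField of cyclotomic_field by <:].

End CyclotomicField.

(* Z[zeta_n] *)
Definition cyclotomic_ring (R : realType) (n : nat) : set R[i] :=
  [set z | exists p : {poly int}, z = (map_poly intr p).[zeta R n]].

Definition in_galois (R : realType) (n : nat)
    (s : {rmorphism cyclotomic_field R n -> cyclotomic_field R n}) : Prop :=
  bijective s /\ forall q : rat, s (ratr q) = ratr q.

(* For 2 < n the index type has totient n / 2 elements.  The last clause says
   that each pair {t, conj o t} of conjugate automorphisms meets the family s
   exactly once. *)
Definition star_choice (R : realType) (n : nat)
    (s : 'I_((totient n)./2.-1).+1 ->
         {rmorphism cyclotomic_field R n -> cyclotomic_field R n}) : Prop :=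
  [/\ s ord0 =1 id,
      forall j, in_galois (s j)
    & forall t : {rmorphism cyclotomic_field R n -> cyclotomic_field R n},
        in_galois t ->
        exists! j, s j =1 t
          \/ forall x, cyclotomic_val (s j x) = conjc (cyclotomic_val (t x))].

Definition plane_coord (R : realType) (z : R[i]) : 'rV[R]_2 :=
  \row_(c < 2) if c == 0 then complex.Re z else complex.Im z.

(* Row j of the matrix is the image in R^2 of z under the j-th automorphism
   other than s_1; thus 'M[R]_(k, 2) plays the part of (R^2)^k. *)
Definition star_map (R : realType) (n : nat)
    (s : 'I_((totient n)./2.-1).+1 ->
         {rmorphism cyclotomic_field R n -> cyclotomic_field R n})
    (z : cyclotomic_field R n) : 'M[R]_((totient n)./2.-1, 2) :=
  \matrix_(j < (totient n)./2.-1)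
    plane_coord (cyclotomic_val (s (lift ord0 j) z)).

Definition is_window (R : realType) (k : nat) (W : set 'M[R]_(k, 2)) : Prop :=
  [/\ W° !=set0, W `<=` closure W° & compact (closure W°)].

Definition model_set (R : realType) (n : nat)
    (s : 'I_((totient n)./2.-1).+1 ->
         {rmorphism cyclotomic_field R n -> cyclotomic_field R n})
    (t : R[i]) (W : set 'M[R]_((totient n)./2.-1, 2)) : set R[i] :=
  [set t + cyclotomic_val z | z in
     [set z : cyclotomic_field R n |
        cyclotomic_ring n (cyclotomic_val z) /\ W (star_map s z)]].

Definition cyclotomic_model_sets (R : realType) (n : nat) : set (set R[i]) :=
  [set L | exists s t W,
     [/\ @star_choice R n s, is_window W & L = model_set s t W]].

(* The supremum is taken in \bar R, so that unbounded sets have diameter +oo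
   (and the empty set -oo). *)
Definition diameter (R : realType) (F : set R[i]) : \bar R :=
  ereal_sup [set (complex.Re `|x - y|)%:E | x in F & y in F].

Definition bounded_subsets (R : realType) (r : R) (S : set R[i]) :
    set (set R[i]) :=
  [set F | F `<=` S /\ (diameter F < r%:E)%E].

Definition parallel (R : realType) (u v : R[i]) : Prop :=
  exists c : R, u = c%:C * v.

Definition cyclotomic_directions (R : realType) (n : nat) : set R[i] :=
  [set u | `|u| = 1 /\
     exists o, [/\ cyclotomic_ring n o, o != 0 & parallel u o]].

Definition line (R : realType) (a u : R[i]) : set R[i] :=
  [set a + c%:C * u | c in [set: R]].

Definition lines_parallel (R : realType) (u : R[i]) : set (set R[i]) :=
  [set line a u | a in [set: R[i]]].

Definition Xray (R : realType) (u : R[i]) (F : set R[i])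
    (l : lines_parallel u) : nat :=
  #|` fset_set (F `&` \val l)|%fset.
Arguments Xray {R} u F l.

(* Finiteness of the members of E is part of the notion: Xray is only
   meaningful on finite sets. *)
Definition determined_by_Xrays (R : realType) (n m : nat)
    (E : set (set R[i])) : Prop :=
  (forall F, E F -> finite_set F) /\
  exists U : set R[i],
    [/\ (U #= `I_m)%card,
        U `<=` cyclotomic_directions n,
        forall u v, U u -> U v -> u <> v -> ~ parallel u v
      & forall F F', E F -> E F' ->
          (forall u, U u -> Xray u F = Xray u F') -> F = F'].

Definition cyclotomic_lines (R : realType) (n : nat) : set (set R[i]) :=
  [set line 0 o | o in [set o | cyclotomic_ring n o /\ o != 0]].

Definition parallel_lines (R : realType) (T T' : set R[i]) : Prop :=
  exists a : R[i], T' = [set a + x | x in T].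

Definition inner (R : realType) (x y : R[i]) : R :=
  complex.Re x * complex.Re y + complex.Im x * complex.Im y.

Definition orthocomplement (R : realType) (T : set R[i]) : set R[i] :=
  [set x | forall y, T y -> inner x y = 0].

(* Orthogonal projection of F on the linear subspace V. *)
Definition projection_on (R : realType) (F V : set R[i]) : set R[i] :=
  [set p | V p /\ exists2 x, F x & forall v, V v -> inner (x - p) v = 0].

Definition determined_by_projections (R : realType) (n m : nat)
    (E : set (set R[i])) : Prop :=
  (forall F, E F -> finite_set F) /\
  exists TT : set (set R[i]),
    [/\ (TT #= `I_m)%card,
        TT `<=` cyclotomic_lines n,
        forall T T', TT T -> TT T' -> T <> T' -> ~ parallel_lines T T'
      & forall F F', E F -> E F' ->
          (forall T, TT T ->
             projection_on F (orthocomplement T)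
             = projection_on F' (orthocomplement T)) -> F = F'].

(* Main.v *)
Require Import Defs.
From mathcomp Require Import all_boot all_order all_algebra.
From mathcomp Require Import all_fingroup cyclic cyclotomic finmap.
From mathcomp Require Import all_classical all_reals all_analysis.
From mathcomp Require Import complex.
From mathcomp Require Import ring lra zify.

(** Let [F] and [F'] lie in a model set [L], with diameters below [r].  Take
    the two directions [1] and [o_k = 1 + k zeta], with [k > 0] to be chosen.
    If [F] and [F'] have the same X-rays (or the same projections) along both,
    then a point [x] of [F] has a point [y = x + c o_k] of [F'] on its line
    parallel to [o_k], and [y] has a point [w = y + c'] of [F] on its
    horizontal line.  Since [x] and [w] both belong to [F], the imaginary part
    [c k Im zeta] of [w - x] is smaller than [r]; since [|o_k| <= 2 k], this
    gives [|y - x| < 2 r / Im zeta], a bound that does not depend on [k].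
    So [y - x] is one of the differences of [L] of length at most
    [2 r / Im zeta].  There are finitely many of them, and a nonzero complex
    number is parallel to at most one [o_k], hence some [o_k] is parallel to none
    of the nonzero ones.  For that [k], [y = x]; thus [F] is contained in [F'],
    and the two sets are equal by symmetry ([line_meets_subset]).

    It remains to see that bounded differences of [L] form a finite set
    ([finite_differences]).  A bounded difference [z] is an element of [Z[zeta]] all
    of whose images [s_j z] are bounded: [s_1 z = z] by assumption, the others
    because they come from the window, which is bounded.  Reducing
    modulo the monic polynomial [Phi_n], write [z = p(zeta)] with [p] an
    integer polynomial of size at most [totient n].  The numbers [s_j zeta] and
    their complex conjugates are [totient n] distinct points, at which [p]
    takes the values [s_j z] and their conjugates.  Inverting the Vandermonde
    matrix of these points bounds the coefficients of [p], which leaves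
    finitely many [p] ([finite_bounded_values]).  The distinctness of the
    points comes from the pairwise inequivalence of the [s_j] and from
    [s_j zeta] being a non-real root of unity. *)

Set Implicit Arguments.
Unset Strict Implicit.
Unset Printing Implicit Defensive.

Import Order.TTheory GRing.Theory Num.Theory.
Import numFieldNormedType.Exports.
Local Open Scope classical_set_scope.
Local Open Scope complex_scope.
Local Open Scope ring_scope.

(** * Roots of unity *)

(** [-1] is an element of order 2 of the unit group of [Z/n]. *)
Lemma totient_even n : (2 < n)%N -> ~~ odd (totient n).
Proof.
move=> hn; rewrite -dvdn2 -card_units_Zp; last by lia.
case: n hn => [|[|[|n]]] // _.
have hu : (-1 : 'Z_n.+3) \is a GRing.unit by rewrite unitrN unitr1.
pose u := FinRing.unit 'Z_n.+3 hu.
have <- : #[u]%g = 2%N.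
  apply/eqP; rewrite eqn_leq; apply/andP; split.
    apply: dvdn_leq => //; rewrite order_dvdn; apply/eqP/val_inj.
    by rewrite FinRing.val_unitX /= sqrrN expr1n.
  rewrite ltnNge; apply/negP => h.
  have /eqP : #[u]%g = 1%N by have := order_gt0 u; lia.
  rewrite order_eq1 => /eqP/(congr1 val) /= /(congr1 val) /=.
  rewrite /Zp_trunc /= !modn_small; lia.
by apply: order_dvdG; rewrite inE.
Qed.

Lemma zetaX (R : realType) n k :
  zeta R n ^+ k = cos (2 * pi / n%:R *+ k) +i* sin (2 * pi / n%:R *+ k).
Proof.
rewrite /zeta; set a := 2 * pi / n%:R.
elim: k => [|k IH]; first by rewrite expr0 mulr0n cos0 sin0.
rewrite exprSr IH mulrSr cosD sinD; simpc.
by congr (_ +i* _); rewrite addrC.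
Qed.

(** The order [d] of [zeta] divides [n]; a proper divisor is at most [n / 2], so
    [2 pi d / n] lies in [[0, pi]], where [cos] takes the value 1 only at 0. *)
Lemma zeta_prim (R : realType) n : (0 < n)%N -> n.-primitive_root (zeta R n).
Proof.
move=> n0; have nR : n%:R != 0 :> R by rewrite pnatr_eq0 -lt0n.
have hz : zeta R n ^+ n = 1.
  rewrite zetaX -mulr_natr divfK // mulr_natl cos2pi.
  by rewrite mulr2n sinDpi sinpi oppr0.
have [d hd dn] := prim_order_exists n0 hz.
have [e|hdn] := eqVneq d n; first by rewrite -{1}e.
have d0 := prim_order_gt0 hd.
have d2 : (d * 2 <= n)%N.
  by have /dvdnP[e ne] := dn; case: e ne => [|[|e]] ne; nia.
have := prim_expr_order hd; rewrite zetaX => -[hc _].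
suff /eqP : 2 * pi / n%:R *+ d = 0 :> R.
  rewrite -mulr_natr !mulf_eq0 invr_eq0 (negPf nR) !pnatr_eq0 (gt_eqF (pi_gt0 R)) /=.
  by move=> h; lia.
apply: cos_inj; rewrite ?cos0 // in_itv /= ?lexx ?pi_ge0 //.
rewrite -mulr_natr mulr_ge0 ?mulr_ge0 ?pi_ge0 ?invr_ge0 //=.
rewrite mulrAC ler_pdivrMr ?ltr0n // mulrAC mulrC ler_wpM2l ?pi_ge0 //.
by rewrite -natrM ler_nat mulnC.
Qed.

(** [X^n - 1] is the product of the [Phi_d] for [d] dividing [n], so [zeta] is a
    root of some [Phi_d]; then [zeta^d = 1], and primitivity forces [d = n]. *)
Lemma root_Phi (R : realType) n : (0 < n)%N ->
  root (map_poly intr 'Phi_n) (zeta R n).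
Proof.
move=> n0; have hp := zeta_prim R n0.
have Xn_sub1E d : (map_poly intr ('X^d - 1)).[zeta R n] = zeta R n ^+ d - 1.
  by rewrite rmorphB /= map_polyXn rmorph1 !hornerE.
have := Xn_sub1E n; rewrite (prim_expr_order hp) subrr -prod_Cyclotomic //.
rewrite rmorph_prod horner_prod => /eqP; rewrite prodf_seq_eq0 => /hasP[d].
rewrite -dvdn_divisors // => dn /= root_d.
suff e : d = n by rewrite rootE -{1}e.
have d0 : (0 < d)%N by apply: dvdn_gt0 dn.
apply/eqP; rewrite eqn_dvd dn /= (prim_order_dvd hp) -subr_eq0 -Xn_sub1E.
rewrite -prod_Cyclotomic // rmorph_prod horner_prod prodf_seq_eq0.
by apply/hasP; exists d => //; rewrite -dvdn_divisors.
Qed.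

Lemma Im_zeta_gt0 (R : realType) n : (2 < n)%N -> 0 < complex.Im (zeta R n).
Proof.
move=> hn; have n0 : 0 < n%:R :> R by rewrite ltr0n; lia.
rewrite /zeta /=; apply: sin_gt0_pi; rewrite divr_gt0 ?mulr_gt0 ?pi_gt0 //=.
by rewrite ltr_pdivrMr // mulrC ltr_pM2l ?pi_gt0 // ltr_nat.
Qed.

(** * Integer polynomials with bounded values *)

(** The coefficients of [p] are linear functions of its values at [N] distinct
    points, through the inverse of the Vandermonde matrix; so they are bounded,
    and integers in a bounded range are finitely many. *)
Lemma finite_bounded_values (R : realType) N (w : 'I_N -> R[i]) (B : R) :
  injective w ->
  finite_set [set p : {poly int} |
    (size p <= N)%N /\ forall i, `|(map_poly intr p).[w i]| <= B%:C].
Proof.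
move=> w_inj.
pose V := Vandermonde N (\row_i w i).
have V_unit : V \in unitmx.
  rewrite unitmxE det_Vandermonde unitfE; apply/prodf_neq0 => i _.
  apply/prodf_neq0 => j ij; rewrite !mxE subr_eq0.
  by apply: contraTneq ij => /w_inj ->; rewrite ltnn.
(* S bounds every coefficient at once, hence the sum over all entries of V^-1. *)
pose S := \sum_i \sum_k `|B%:C| * `|invmx V i k|.
pose M := Num.bound (complex.Re S).
(* Shifting by M encodes the integers of [-M, M] by the ordinals below 2M + 1. *)
pose f (g : {ffun 'I_N -> 'I_(M.*2.+1)}) : {poly int} :=
  \poly_(k < N) (oapp (fun k : 'I_N => (g k : nat)%:Z - M%:Z) 0 (insub k)).
apply: (@sub_finite_set _ _ (f @` setT)); last exact/finite_image/finite_finset.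
move=> p [szp hp].
have coef_le (k : 'I_N) : (absz (p`_k)%R <= M)%N.
  pose c : 'rV[R[i]]_N := \row_k (p`_k)%:~R.
  pose v : 'rV[R[i]]_N := \row_i (map_poly intr p).[w i].
  have cV : c *m V = v.
    apply/rowP => i; rewrite !mxE.
    rewrite (horner_coef_wide _ (leq_trans (size_poly _ _) szp)).
    by apply: eq_bigr => j _; rewrite !mxE coef_map.
  have {}cV : c = v *m invmx V by rewrite -cV mulmxK.
  have : `|(p`_k)%:~R| <= S.
    have -> : (p`_k)%:~R = c 0 k by rewrite mxE.
    rewrite cV mxE; apply: le_trans (ler_norm_sum _ _ _) _; apply: ler_sum => i _.
    rewrite normrM mxE (bigD1 k) //=.
    apply: le_trans (_ : `|B%:C| * `|invmx V i k| <= _).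
      apply: ler_wpM2r => //; apply: le_trans (hp i) _.
      by apply: real_ler_norm; apply/complex_realP; exists B.
    rewrite lerDl; apply: sumr_ge0 => j _; exact: mulr_ge0.
  rewrite -intr_norm -(rmorph_int (real_complex R)) lecE /= => /andP[_ le_S].
  have S_ge0 : 0 <= complex.Re S by apply: le_trans le_S; rewrite ler0z.
  have := le_lt_trans le_S (archi_boundP S_ge0).
  by rewrite pmulrn ltr_int; lia.
exists [ffun k : 'I_N => inord (absz (p`_k + M%:Z))] => //.
apply/polyP => k; rewrite coef_poly; case: ltnP => hk.
  rewrite insubT /= ffunE inordK; have /= := coef_le (Ordinal hk); lia.
by rewrite nth_default // (leq_trans szp hk).
Qed.

(** * The cyclotomic field and its conjugate points *)

Lemma zeta_in_cyclotomic (R : realType) n : zeta R n \in cyclotomic_pred R n.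
Proof. by apply/asboolP => S _. Qed.

Definition zetaK (R : realType) n : cyclotomic_field R n :=
  CyclotomicField (zeta_in_cyclotomic R n).

(** The elements on which two morphisms agree form a subfield, and the
    cyclotomic field is the smallest one containing [zeta]. *)
Lemma cyclotomic_rmorph_eq (R : realType) n
    (f g : {rmorphism cyclotomic_field R n -> R[i]}) :
  f (zetaK R n) = g (zetaK R n) -> f =1 g.
Proof.
move=> fg x.
pose S : {pred R[i]} :=
  fun y => `[< exists2 z : cyclotomic_field R n, \val z = y & f z = g z >].
suff : \val x \in S by move=> /asboolP[z /val_inj <-].
have /asboolP := valP x; apply; last by apply/asboolP; exists (zetaK R n).
split=> [|_ _ /asboolP[y <- fgy] /asboolP[z <- fgz]
         |_ _ /asboolP[y <- fgy] /asboolP[z <- fgz]]; apply/asboolP.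
- by exists 1; rewrite !rmorph1.
- by exists (y - z); rewrite !rmorphB ?fgy ?fgz.
- by exists (y / z); rewrite ?fmorph_div ?fgy ?fgz.
Qed.

Lemma cyclotomic_rmorph_horner (R : realType) n
    (f : {rmorphism cyclotomic_field R n -> R[i]}) (p : {poly int})
    (z : cyclotomic_field R n) :
  \val z = (map_poly intr p).[zeta R n] ->
  f z = (map_poly intr p).[f (zetaK R n)].
Proof.
have intr_map (g : {rmorphism cyclotomic_field R n -> R[i]}) :
    g (map_poly intr p).[zetaK R n] = (map_poly intr p).[g (zetaK R n)].
  rewrite -horner_map -map_poly_comp; congr (_.[_]).
  by apply: eq_map_poly => k /=; rewrite rmorph_int.
move=> zE; rewrite -intr_map; congr (f _); apply: val_inj.
by rewrite zE (intr_map \val).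
Qed.

Lemma cyclotomic_ring_reduce (R : realType) n z : (0 < n)%N ->
  cyclotomic_ring n z ->
  exists p : {poly int}, (size p <= totient n)%N /\
    z = (map_poly intr p).[zeta R n].
Proof.
move=> n0 [p ->]; have mon := Cyclotomic_monic n.
exists (polydiv.Pdiv.IdomainDefs.modp p 'Phi_n); split.
  rewrite -ltnS -size_Cyclotomic.
  by rewrite polydiv.Pdiv.Idomain.ltn_modp monic_neq0.
rewrite {1}(polydiv.Pdiv.IdomainMonic.divp_eq mon p) rmorphD rmorphM hornerD hornerM.
by have /rootP -> := root_Phi R n0; rewrite mulr0 add0r.
Qed.

Section StarMap.
Variables (R : realType) (n : nat).
Variable s : 'I_((totient n)./2.-1).+1 ->
  {rmorphism cyclotomic_field R n -> cyclotomic_field R n}.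
Hypotheses (hn : (2 < n)%N) (hs : star_choice s).

(** Both [i] and [j] represent the automorphism [s j] up to complex conjugation,
    and its representative is unique. *)
Lemma star_choice_inj i j :
  s i =1 s j \/ (forall x, \val (s i x) = conjc (\val (s j x))) -> i = j.
Proof.
case: hs => _ gal uniq_s sij.
have [k [_ k_uniq]] := uniq_s _ (gal j).
by rewrite -(k_uniq i) // -(k_uniq j) //; left.
Qed.

(** A real number of modulus 1 has square 1, whereas the image of [zeta] is a
    root of unity of exact order [n > 2]. *)
Lemma star_choice_nonreal i :
  conjc (\val (s i (zetaK R n))) != \val (s i (zetaK R n)).
Proof.
have n0 : (0 < n)%N by lia.
pose f : {rmorphism cyclotomic_field R n -> R[i]} := \val \o s i.
have fX1 k : (f (zetaK R n) ^+ k == 1) = (n %| k)%N.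
  rewrite (prim_order_dvd (zeta_prim R n0)) -rmorphXn -(rmorph1 f) fmorph_eq.
  by rewrite -val_eqE rmorphXn rmorph1.
apply/eqP => real; have real_f : conjc (f (zetaK R n)) = f (zetaK R n) := real.
have norm1 : `|f (zetaK R n)| = 1.
  have := fX1 n; rewrite dvdnn => /eqP/(congr1 Num.norm)/eqP.
  by rewrite normrX normr1 pexpr_eq1 // => /eqP.
have : f (zetaK R n) ^+ 2 == 1.
  by rewrite expr2 -{2}real_f -sqr_normc norm1 expr1n.
by rewrite fX1 => /dvdn_leq; lia.
Qed.

(** Listing both members of each conjugate pair supplies as many interpolation
    points as [Phi_n] has roots. *)
Definition conjugate_points
    (i : 'I_(((totient n)./2.-1).+1 + ((totient n)./2.-1).+1)) : R[i] :=
  match fintype.split i with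
  | inl j => \val (s j (zetaK R n))
  | inr j => conjc (\val (s j (zetaK R n)))
  end.

Lemma conjugate_points_inj : injective conjugate_points.
Proof.
have eq_s i j : \val (s i (zetaK R n)) = \val (s j (zetaK R n)) -> i = j.
  move=> e; apply: star_choice_inj; left => x; apply: val_inj.
  exact: (@cyclotomic_rmorph_eq _ _ (\val \o s i) (\val \o s j)).
have neq_conj i j : \val (s i (zetaK R n)) <> conjc (\val (s j (zetaK R n))).
  move=> e; have ij : i = j.
    apply: star_choice_inj; right => x.
    exact: (@cyclotomic_rmorph_eq _ _ (\val \o s i) (@conjc R \o (\val \o s j))).
  by have /eqP := star_choice_nonreal i; apply; rewrite {2}e ij.
move=> a b; rewrite /conjugate_points => e; apply: (can_inj (@splitK _ _)).
move: e; case: (fintype.split a) => i; case: (fintype.split b) => j.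
- by move=> /eq_s ->.
- by move=> /neq_conj.
- by move=> /esym/neq_conj.
- by move=> /(inv_inj (@conjcK R))/eq_s ->.
Qed.

(** Discreteness of [Z[zeta]] in its Minkowski embedding. *)
Lemma finite_bounded_conjugates (B : R) :
  finite_set [set \val z | z in [set z : cyclotomic_field R n |
    cyclotomic_ring n (\val z) /\ forall j, `|\val (s j z)| <= B%:C]].
Proof.
have n0 : (0 < n)%N by lia.
apply: (sub_finite_set _
  (finite_image (fun p : {poly int} => (map_poly intr p).[zeta R n])
    (finite_bounded_values B conjugate_points_inj))).
move=> _ [z [/(cyclotomic_ring_reduce n0)[p [szp zE]] zB] <-].
exists p => //; split.
  apply: leq_trans szp _.
  (* Evenness makes totient n exactly twice the number of indices. *)
  have := totient_even hn; have := totient_gt0 n; lia.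
move=> i; rewrite /conjugate_points; case: (fintype.split i) => j.
  by rewrite -(@cyclotomic_rmorph_horner _ _ (\val \o s j) _ _ zE); apply: zB.
rewrite -(@cyclotomic_rmorph_horner _ _ (@conjc R \o (\val \o s j)) _ _ zE) /=.
by rewrite normcJ; apply: zB.
Qed.

End StarMap.

(** * Finiteness of bounded differences *)

Lemma window_bounded (R : realType) k (W : set 'M[R]_(k, 2)) : is_window W ->
  exists B : R, forall M, W M -> forall i j, `|M i j| <= B.
Proof.
case=> _ Wsub /compact_bounded[B [_ hB]].
exists (B + 1) => M /Wsub WM i j.
apply: le_trans (hB (B + 1) _ _ WM); last by rewrite ltrDl.
rewrite [leRHS]mx_normrE; exact: (le_bigmax _ (fun ij => `|M ij.1 ij.2|) (i, j)).
Qed.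

Lemma norm_le_plane_coord (R : realType) (z : R[i]) (B : R) :
  (forall c, `|plane_coord z 0 c| <= B) -> `|z| <= (B + B)%:C.
Proof.
move=> zB; have := zB 0; have := zB 1; rewrite !mxE /= => ImB ReB.
rewrite [z]complexE; apply: le_trans (ler_normD _ _) _.
rewrite normrM !normc_def /= !expr0n /= !addr0 expr1n add0r sqrtr1 mul1r -rmorphD /=.
by rewrite lecR !sqrtr_sqr lerD.
Qed.

Lemma cyclotomic_ringB (R : realType) n (x y : R[i]) :
  cyclotomic_ring n x -> cyclotomic_ring n y -> cyclotomic_ring n (x - y).
Proof. by move=> [p ->] [q ->]; exists (p - q); rewrite rmorphB hornerD hornerN. Qed.

(** The translation [t] cancels in a difference; what is left is an element of
    [Z[zeta]] whose first conjugate is bounded by [rho] and whose other ones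
    are bounded through the window. *)
Lemma finite_differences (R : realType) (n : nat) (L : set R[i]) (rho : R) :
  (2 < n)%N -> cyclotomic_model_sets n L ->
  finite_set [set d | `|d| <= rho%:C /\ exists x y, [/\ L x, L y & d = x - y]].
Proof.
move=> hn [s [t [W [hs hW ->]]]].
have [B hB] := window_bounded hW.
pose C := Num.max rho ((B + B) + (B + B)).
apply: sub_finite_set (finite_bounded_conjugates hn hs C).
move=> d [d_rho [_ [_ [[x [xO xW] <-] [y [yO yW] <-] dE]]]].
have {}dE : d = \val (x - y) by rewrite dE opprD addrACA subrr add0r rmorphB.
exists (x - y) => //; split; first by rewrite rmorphB; exact: cyclotomic_ringB.
have [s0 _ _] := hs.
have far (z : cyclotomic_field R n) j : W (star_map s z) ->
    `|\val (s (lift ord0 j) z)| <= (B + B)%:C.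
  by move=> /hB zW; apply: norm_le_plane_coord => c; have := zW j c; rewrite !mxE.
move=> j; case: (unliftP ord0 j) => [k|] ->; last first.
  by rewrite s0 -dE (le_trans d_rho) // lecR le_max lexx.
rewrite !rmorphB (le_trans (ler_normB _ _)) //.
apply: le_trans (lerD (far _ _ xW) (far _ _ yW)) _.
by rewrite -rmorphD /= lecR le_max lexx orbT.
Qed.

Lemma dist_lt_diameter (R : realType) (F : set R[i]) (r : R) x y :
  (diameter F < r%:E)%E -> F x -> F y -> `|x - y| < r%:C.
Proof.
move=> Fr Fx Fy; rewrite normc_def ltcR -lte_fin; apply: le_lt_trans Fr.
apply: ereal_sup_ubound; exists x => //; exists y => //.
by rewrite normc_def.
Qed.

Lemma bounded_subsets_finite (R : realType) n (L : set R[i]) (r : R) F :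
  (2 < n)%N -> cyclotomic_model_sets n L -> bounded_subsets r L F -> finite_set F.
Proof.
move=> hn hL [FL Fr]; have [->|/set0P[x Fx]] := eqVneq F set0.
  exact: finite_set0.
apply: sub_finite_set (finite_image (fun d => x - d) (finite_differences r hn hL)).
move=> y Fy; exists (x - y); last by rewrite subKr.
by split; [apply/ltW/(dist_lt_diameter Fr) | exists x, y; split=> //; apply: FL].
Qed.

(** * A generic second direction *)

(** In the basis [(1, zeta)], the ratio of the coordinates of a nonzero multiple
    of [1 + k zeta] is [k]; the finitely many elements of [D] take only finitely
    many ratios. *)
Lemma generic_direction (R : realType) n (D : set R[i]) :
  (2 < n)%N -> finite_set D ->
  exists k : nat, forall (d : R[i]) (c : R), D d ->
    d = c%:C * (1 + k.+1%:R%:C * zeta R n) -> c = 0.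
Proof.
move=> hn finD.
pose t := complex.Im (zeta R n); pose b := complex.Re (zeta R n).
have t0 : t != 0 by rewrite gt_eqF // Im_zeta_gt0.
(* Ratio of the zeta-coordinate to the 1-coordinate; the denominator is c when
   d = c (1 + k zeta). *)
pose slope (d : R[i]) : R :=
  (complex.Im d / t) / (complex.Re d - complex.Im d * b / t).
have [k Dk] : exists k : nat, ~ (slope @` D) k.+1%:R.
  apply: contrapT => /forallNP hk; apply: infinite_nat.
  apply: sub_finite_set (finite_preimage _ (finite_image slope finD)) => [k _|].
    by apply: contrapT; exact: hk.
  by move=> i j _ _ /eqP; rewrite eqr_nat => /eqP[].
exists k => d c Dd dE; apply/eqP/negP => /negP c0; apply: Dk; exists d => //.
have zE : zeta R n = b +i* t by [].
have ImE : complex.Im d / t = c * k.+1%:R.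
  by rewrite dE zE /= !mul0r !addr0 add0r mulrA mulfK.
have ReE : complex.Re d = c + c * k.+1%:R * b.
  by rewrite dE zE /=; ring.
by rewrite /slope [_ * b / t]mulrAC ImE ReE addrK mulrAC divff ?mul1r.
Qed.

(** Common consequence of equal X-rays in the direction [u] and of equal
    projections along [u], through which both halves of the theorem are proved
    at once. *)
Definition line_meets (R : realType) (u : R[i]) (F F' : set R[i]) : Prop :=
  forall x, F x -> exists2 y, F' y & exists c : R, y = x + c%:C * u.

(** From [x] in [F] go to [y] in [F'] along [o = 1 + k zeta], then to [w] in [F]
    along [1].  The imaginary part of [w - x] controls [c] in [y = x + c o], and
    the resulting bound on [y - x] is uniform in [k]; genericity of [k] then
    forces [c = 0]. *)
Lemma line_meets_subset (R : realType) n (L : set R[i]) (r : R) :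
  (2 < n)%N -> cyclotomic_model_sets n L ->
  exists k : nat, forall F F',
    bounded_subsets r L F -> bounded_subsets r L F' ->
    line_meets (1 + k.+1%:R%:C * zeta R n) F F' -> line_meets 1 F' F -> F `<=` F'.
Proof.
move=> hn hL; pose t := complex.Im (zeta R n).
have t0 : 0 < t by exact: Im_zeta_gt0.
have zE : zeta R n = complex.Re (zeta R n) +i* t by [].
have [k hk] := generic_direction hn (finite_differences (2 * r / t) hn hL).
exists k => F F' [FL Fr] [F'L F'r] mo m1 x Fx.
have [y Fy [c yE]] := mo _ Fx; have [w Fw [c' wE]] := m1 _ Fy.
have K0 : 0 < k.+1%:R :> R by rewrite ltr0n.
have c_lt : `|c| * k.+1%:R * t < r.
  have := dist_lt_diameter Fr Fw Fx.
  rewrite wE yE normc_def ltcR; apply: le_lt_trans.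
  rewrite (_ : `|c| * k.+1%:R * t = `|c * k.+1%:R * t|); last first.
    by rewrite !normrM (gtr0_norm t0) (gtr0_norm K0).
  rewrite -sqrtr_sqr ler_wsqrtr // -[leLHS]add0r lerD ?sqr_ge0 //.
  rewrite le_eqVlt; apply/orP; left; apply/eqP.
  by rewrite zE mulr1 addrAC [x + _]addrC addrK /=; congr (_ ^+ 2); ring.
suff c0 : c = 0 by rewrite c0 mul0r addr0 in yE; rewrite -yE.
apply: (hk (y - x) c); last by rewrite yE addrAC subrr add0r.
split; last by exists y, x; split; [exact: F'L | exact: FL|].
rewrite yE addrAC subrr add0r normrM.
have : `|1 + k.+1%:R%:C * zeta R n| <= (1 + k.+1%:R)%:C.
  rewrite (le_trans (ler_normD _ _)) // normr1 normrM rmorphD /= lerD2l.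
  rewrite [X in _ * X <= _]normc_def /= cos2Dsin2 sqrtr1 mulr1.
  by rewrite normc_def /= expr0n addr0 sqrtr_sqr ger0_norm.
move=> /(ler_wpM2l (normr_ge0 c%:C)) /le_trans; apply.
have -> : `|c%:C| = `|c|%:C by rewrite normc_def /= expr0n addr0 sqrtr_sqr.
rewrite -rmorphM /= lecR ler_pdivlMr //.
(* |c| (1 + k) <= 2 |c| k because k >= 1. *)
have K1 : 0 <= k.+1%:R - 1 :> R by rewrite subr_ge0 ler1n.
have := mulr_ge0 (mulr_ge0 (normr_ge0 c) (ltW t0)) K1; nra.
Qed.

(** * Recovering line incidences from X-rays and projections *)

Lemma parallel_sym (R : realType) (u v : R[i]) :
  u != 0 -> parallel u v -> parallel v u.
Proof.
move=> u0 [c uE]; exists c^-1; rewrite uE mulrA -rmorphM mulVf ?mul1r //.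
by apply: contraNneq u0 => c0; rewrite uE c0 mul0r.
Qed.

Lemma card_pair (T : choiceType) (a b : T) : a != b -> ([set a; b] #= `I_2)%card.
Proof.
move=> ab; have -> : [set a; b] = [set` [fset a; b]%fset].
  apply/seteqP; split=> x /=; rewrite !inE.
    by move=> [] ->; rewrite eqxx ?orbT.
  by move=> /orP[] /eqP ->; [left|right].
by apply/card_eq_fsetP; rewrite cardfs2 ab.
Qed.

(** On finite sets a positive X-ray value detects that a line meets the set. *)
Lemma determined_by_two_Xrays (R : realType) n (E : set (set R[i]))
    (o1 o2 : R[i]) :
  cyclotomic_ring n o1 -> cyclotomic_ring n o2 -> o1 != 0 -> o2 != 0 ->
  ~ parallel o1 o2 ->
  (forall F, E F -> finite_set F) ->
  (forall F F', E F -> E F' ->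
     (forall o, o = o1 \/ o = o2 -> line_meets o F F' /\ line_meets o F' F) ->
     F = F') ->
  determined_by_Xrays n 2 E.
Proof.
move=> o1R o2R o1n o2n npar Efin Eeq; split=> //.
(* Directions are unit vectors, so o1 and o2 have to be normalized. *)
have unit_mul (o : R[i]) : o != 0 -> exists2 nu : R, nu != 0 & `|nu%:C * o| = 1.
  rewrite -normr_gt0 => o_gt0; have o_real := gtr0_real o_gt0.
  have oE : (complex.Re `|o|)%:C = `|o| by rewrite RRe_real.
  exists (complex.Re `|o|)^-1.
    by rewrite invr_eq0; apply: contraTneq o_gt0 => e; rewrite -oE e ltxx.
  by rewrite normrM fmorphV /= oE normfV normr_id mulVf // gt_eqF.
have [a a0 a1] := unit_mul _ o1n; have [b b0 b1] := unit_mul _ o2n.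
have par12 u v : u = a%:C * o1 -> v = b%:C * o2 -> ~ parallel u v.
  move=> -> -> [c e]; apply: npar; exists (a^-1 * (c * b)).
  rewrite !rmorphM /= fmorphV -!mulrA -e mulKf //.
  by rewrite -(inj_eq (@complexI R)) in a0.
have par21 u v : u = b%:C * o2 -> v = a%:C * o1 -> ~ parallel u v.
  move=> uE vE /parallel_sym; rewrite -normr_eq0 {1}uE b1 oner_eq0 => /(_ isT).
  exact: par12.
have meets_of_Xray (u o : R[i]) (nu : R) F F' : E F -> E F' -> u = nu%:C * o ->
    Xray u F = Xray u F' -> line_meets o F F'.
  move=> EF EF' uE XF x Fx.
  have lu : lines_parallel u (line x u) by exists x.
  have := congr1 (fun f => f (exist _ (line x u) (mem_set lu))) XF.
  rewrite /Xray /=.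
  set A := F `&` _; set A' := F' `&` _ => cardA.
  have finA : finite_set A by apply: finite_setIl; apply: Efin.
  have finA' : finite_set A' by apply: finite_setIl; apply: Efin.
  have xA : x \in fset_set A.
    by rewrite in_fset_set // inE; split=> //; exists 0 => //; rewrite mul0r addr0.
  have : (0 < #|` fset_set A'|)%N.
    by rewrite -cardA cardfs_gt0; apply/fset0Pn; exists x.
  rewrite cardfs_gt0 => /fset0Pn[y]; rewrite in_fset_set // inE => -[F'y [c _ yE]].
  by exists y => //; exists (c * nu); rewrite -yE uE mulrA -rmorphM.
exists [set a%:C * o1; b%:C * o2]; split.
- apply: card_pair; apply/eqP => e; apply: (par12 _ _ erefl erefl).
  by exists 1; rewrite mul1r.
- move=> _ [] ->; split=> //; [exists o1 | exists o2]; split=> //.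
  + by exists a.
  + by exists b.
- move=> u v [] uE [] vE; rewrite ?uE ?vE // => _; [exact: par12|exact: par21].
- move=> F F' EF EF' XF; apply: Eeq => // _ [] ->; split.
  + by apply: (meets_of_Xray (a%:C * o1) _ a) => //; apply: XF; left.
  + by apply: (meets_of_Xray (a%:C * o1) _ a) => //; apply/esym/XF; left.
  + by apply: (meets_of_Xray (b%:C * o2) _ b) => //; apply: XF; right.
  + by apply: (meets_of_Xray (b%:C * o2) _ b) => //; apply/esym/XF; right.
Qed.

(** In the plane, a vector [(a, b)] orthogonal to [(- f, e)] is a multiple of
    [(e, f)], with the coefficient of the orthogonal projection. *)
Lemma orthogonal_proportional (K : realFieldType) (a b e f : K) :
  e * e + f * f != 0 -> a * - f + b * e = 0 ->
  a = (a * e + b * f) / (e * e + f * f) * e /\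
  b = (a * e + b * f) / (e * e + f * f) * f.
Proof.
move=> q0 ef; split; apply: (mulIf q0); rewrite mulrAC divfK //; apply/eqP.
  by rewrite -subr_eq0 (_ : _ - _ = - f * (a * - f + b * e)); [rewrite ef mulr0|ring].
by rewrite -subr_eq0 (_ : _ - _ = e * (a * - f + b * e)); [rewrite ef mulr0|ring].
Qed.

(** If [y] has the same projection [p] as [x] then [y - p], like [x - p], is
    orthogonal to the complement of the line, hence a multiple of [o]. *)
Lemma line_meets_of_projection (R : realType) (o : R[i]) (F F' : set R[i]) :
  o != 0 ->
  projection_on F (orthocomplement (line 0 o))
    = projection_on F' (orthocomplement (line 0 o)) -> line_meets o F F'.
Proof.
move=> o0 projE x Fx.
pose q := inner o o.
have q0 : q != 0.
  rewrite /q /inner -!expr2; apply: contraNneq o0 => /eqP.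
  by rewrite paddr_eq0 ?sqr_ge0 // !sqrf_eq0 eq_complex.
have innerZl (c : R) y z : inner (c%:C * y) z = c * inner y z.
  by case: y => a b; case: z => e f; rewrite /inner /=; ring.
have innerC (y z : R[i]) : inner y z = inner z y by rewrite /inner; ring.
have innerBl (y z w : R[i]) : inner (y - z) w = inner y w - inner z w.
  by case: y => a b; case: z => e f; rewrite /inner /=; ring.
have orthoP (v : R[i]) : orthocomplement (line 0 o) v <-> inner v o = 0.
  split=> [|vo _ [c _ <-]]; first by apply; exists 1 => //; rewrite add0r mul1r.
  by rewrite add0r innerC innerZl innerC vo mulr0.
pose l := inner x o / q; pose p := x - l%:C * o.
have : projection_on F (orthocomplement (line 0 o)) p.
  split; first by apply/orthoP; rewrite innerBl innerZl divfK // subrr.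
  exists x => // v /orthoP vo.
  by rewrite /p opprB addrC subrK innerZl innerC vo mulr0.
rewrite projE => -[_ [y F'y py]].
exists y => //; exists (inner (y - p) o / q - l).
have /py : orthocomplement (line 0 o) (- complex.Im o +i* complex.Re o).
  by apply/orthoP; rewrite /inner /=; ring.
have -> : x + (inner (y - p) o / q - l)%:C * o = p + (inner (y - p) o / q)%:C * o.
  by rewrite rmorphB mulrBl /p addrAC -addrA.
move=> yp; rewrite -[LHS](addrNK p) addrC; congr (_ + _).
move: q0 yp; rewrite /q; case: (y - p) => a b; case: (o) => e f; rewrite /inner /=.
by move=> q0 /(orthogonal_proportional q0)[aE bE]; simpc; rewrite -aE -bE.
Qed.

(** Lines through the origin are translates of one another only when they are
    equal, so their non-parallelism is that of the vectors. *)
Lemma determined_by_two_projections (R : realType) n (E : set (set R[i]))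
    (o1 o2 : R[i]) :
  cyclotomic_ring n o1 -> cyclotomic_ring n o2 -> o1 != 0 -> o2 != 0 ->
  ~ parallel o1 o2 ->
  (forall F, E F -> finite_set F) ->
  (forall F F', E F -> E F' ->
     (forall o, o = o1 \/ o = o2 -> line_meets o F F' /\ line_meets o F' F) ->
     F = F') ->
  determined_by_projections n 2 E.
Proof.
move=> o1R o2R o1n o2n npar Efin Eeq; split=> //.
have parallel_of_lines (o o' : R[i]) :
    parallel_lines (line 0 o) (line 0 o') -> parallel o' o.
  move=> [a aE].
  have [_ [c _ <-] c0] : [set a + x | x in line 0 o] 0.
    by rewrite -aE; exists 0 => //; rewrite mul0r addr0.
  have [_ [c' _ <-] c1] : [set a + x | x in line 0 o] o'.
    by rewrite -aE; exists 1 => //; rewrite add0r mul1r.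
  exists (c' - c); have : o' - 0 = (a + (0 + c'%:C * o)) - (a + (0 + c%:C * o)).
    by rewrite c0 c1.
  by rewrite subr0 => ->; rewrite !add0r opprD addrACA subrr add0r rmorphB mulrBl.
have npar12 : ~ parallel_lines (line 0 o1) (line 0 o2).
  by move=> /parallel_of_lines /(parallel_sym o2n)/npar.
have npar21 : ~ parallel_lines (line 0 o2) (line 0 o1).
  by move=> /parallel_of_lines/npar.
exists [set line 0 o1; line 0 o2]; split.
- apply: card_pair; apply/eqP => e; apply: npar12; rewrite -e; exists 0.
  by apply/seteqP; split=> [x ox|_ [x ox <-]]; [exists x => //|]; rewrite add0r.
- by move=> _ [] ->; [exists o1 | exists o2].
- by move=> T T' [] -> [] ->.
- move=> F F' EF EF' XF; apply: Eeq => // _ [] ->; split.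
  + by apply: line_meets_of_projection => //; apply: XF; left.
  + by apply: line_meets_of_projection => //; apply/esym/XF; left.
  + by apply: line_meets_of_projection => //; apply: XF; right.
  + by apply: line_meets_of_projection => //; apply/esym/XF; right.
Qed.

Theorem corollary11 (R : realType) (n : nat) (hn : (2 < n)%N)
    (L : set R[i]) (hL : cyclotomic_model_sets n L) (r : R) (hr : 0 < r) :
  determined_by_Xrays n 2 (bounded_subsets r L) /\
  determined_by_projections n 2 (bounded_subsets r L).
Proof.
have [k hk] := line_meets_subset r hn hL.
pose o := 1 + k.+1%:R%:C * zeta R n.
have t0 := Im_zeta_gt0 R hn.
have Im_o : complex.Im o != 0.
  rewrite (_ : complex.Im o = k.+1%:R * complex.Im (zeta R n)); last first.
    by rewrite /= mul0r addr0 add0r.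
  by rewrite mulf_neq0 ?pnatr_eq0 // gt_eqF.
have o_neq0 : o != 0 by apply: contraNneq Im_o => ->.
have ring1 : cyclotomic_ring n (1 : R[i]) by exists 1; rewrite rmorph1 hornerC.
have ring_o : cyclotomic_ring n o.
  exists (1 + k.+1%:R *: 'X); rewrite rmorphD /= rmorph1 hornerD hornerC.
  by rewrite /o map_polyZ map_polyX hornerZ hornerX /= !rmorph_nat.
have npar : ~ parallel o 1.
  by move=> [c /(congr1 (@complex.Im R)) oE]; move: Im_o; rewrite oE mulr1 eqxx.
have fin F := @bounded_subsets_finite R n L r F hn hL.
have determined F F' : bounded_subsets r L F -> bounded_subsets r L F' ->
    (forall u, u = o \/ u = 1 -> line_meets u F F' /\ line_meets u F' F) -> F = F'.
  move=> EF EF' meets; have [oF oF'] := meets _ (or_introl erefl).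
  have [uF uF'] := meets _ (or_intror erefl).
  by apply/seteqP; split; apply: hk.
by split; [apply: (@determined_by_two_Xrays _ _ _ o 1)
          |apply: (@determined_by_two_projections _ _ _ o 1)] => //; exact: oner_neq0.
Qed.
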